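(* Let $(X_n)_{n\ge0}$ be the nearest neighbour random walk on the directed cover $\mathcal{T}$ of $G$ with transition data $p_G(i,j)$, $p(-i)$, and let $M=(m(i,j))_{i,j\in G}$ with $m(i,j)=p(i,j)/p(-i)$. Then $(X_n)$ is recurrent if $\lambda^+(M)<1$ and transient if $\lambda^+(M)>1$. In the critical case $\lambda^+(M)=1$ it may be transient or recurrent, i.e. there exist such random walks with $\lambda^+(M)=1$ that are transient and such random walks with $\lambda^+(M)=1$ that are recurrent.
   Context: $G$ is a countable directed graph, strongly connected, of bounded geometry (uniformly bounded vertex degrees), without multiple edges; $i_0\in G$. The directed cover $\mathcal{T}$ of $G$ rooted in $i_0$ is the rooted tree with vertices labelled by $\tau:\mathcal{T}\to G$: the root $o$ has label $i_0$, and recursively a vertex with label $i$ has exactly one direct descendant with label $j$ for each edge $(i,j)$ of $G$ and no others. $x^-$ denotes the direct ancestor of $x\neq o$. Given are transition probabilities $p_G(i,j)$ on $G$ (stochastic, with $p_G(i,j)>0$ iff there is an edge from $i$ to $j$) and backward probabilities $p(-i)\in(0,1)$, $i\in G$, such that for some $\varepsilon\in(0,1)$, $\varepsilon<p(-i)<1-\varepsilon$ for all $i$. Put $p(i,j)=(1-p(-i))p_G(i,j)$. A loop is added at the root. The random walk $(X_n)$ on $\mathcal{T}$ starts at $o$ and has transition probabilities $p(x,y)=p(\tau(x),\tau(y))$ if $y^-=x$; $p(x,x^-)=p(-\tau(x))$ for $x\ne o$; $p(o,o)=p(-i_0)$; and $0$ otherwise. The upper Collatz-Wielandt number of a non-negative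 matrix $M$ with bounded row sums, acting on $\ell_\infty(G)$ by $Mf(x)=\sum_y m(x,y)f(y)$, is $\lambda^+(M)=\sup\{\lambda>0:\ \exists\,0<f\in\ell_\infty:\ Mf\ge\lambda f\}$, where $0<f$ means $f\ge0$ pointwise and $f\ne0$. *)

(* Defs.v *)
From HB Require Import structures.
From mathcomp Require Import all_boot all_order all_algebra.
From mathcomp Require Import all_classical all_reals all_analysis.

Set Implicit Arguments.
Unset Strict Implicit.
Unset Printing Implicit Defensive.

Import Order.TTheory GRing.Theory Num.Theory.

Local Open Scope classical_set_scope.
Local Open Scope ring_scope.

(* A directed graph without multiple edges on a countable vertex set G is a
   relation E on G; loops are allowed, and G may be finite. *)
Section Graph.
Variables (G : countType) (E : rel G).

Definition strongly_connected : Prop :=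
  forall i j : G, exists s : seq G, path E i s /\ last i s = j.

(* Both the out-degrees and the in-degrees are uniformly bounded. *)
Definition bounded_geometry : Prop :=
  exists D : nat, forall i : G,
    ([set j | E i j] #<= `I_D)%card /\ ([set j | E j i] #<= `I_D)%card.

End Graph.

(* The vertices of the directed cover rooted in i0 are the finite directed
   paths of G starting at i0, a path being stored as the sequence of its
   vertices without i0. *)
Definition dcover (G : countType) (E : rel G) (i0 : G) : Type :=
  {s : seq G | path E i0 s}.

Section DirectedCover.
Variables (G : countType) (E : rel G) (i0 : G).
Implicit Types x y : dcover E i0.

Definition droot : dcover E i0 := exist _ [::] isT.

Definition dlabel x : G := last i0 (sval x).

(* The direct ancestor drops the last vertex of the path; the root, which has
   no ancestor, is sent to itself by convention. *)
Definition danc x : dcover E i0 :=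
  exist _ (take (size (sval x)).-1 (sval x)) (take_path _ (svalP x)).

Definition is_child x y : bool := (y != droot) && (danc y == x).

Lemma is_childE x y : is_child x y = (sval y == rcons (sval x) (dlabel y)).
Proof.
rewrite /is_child /dlabel -!val_eqE /=.
case: x y => [s ps] [t pt] /=; case/lastP: t pt => [|t j] pt /=.
  by case: s ps.
rewrite last_rcons size_rcons /= -cats1 take_size_cat // cats1 eqseq_rcons eqxx.
by rewrite andbT -size_eq0 size_rcons.
Qed.

Lemma dlabel_root : dlabel droot = i0.
Proof. by []. Qed.

Lemma is_child_edge x y : is_child x y -> E (dlabel x) (dlabel y).
Proof.
rewrite is_childE => /eqP xy; have := svalP y.
by rewrite xy rcons_path => /andP[].
Qed.

Lemma edge_is_child x (j : G) : E (dlabel x) j ->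
  exists! y, is_child x y /\ dlabel y = j.
Proof.
move=> xj; have py : path E i0 (rcons (sval x) j).
  by rewrite rcons_path (svalP x).
exists (exist (fun s => path E i0 s) _ py); split.
  by rewrite is_childE /dlabel /= last_rcons.
move=> y [+ yj]; rewrite is_childE yj => /eqP xy.
by apply: val_inj; rewrite /= xy.
Qed.

End DirectedCover.

Section Transitions.
Variables (R : realType) (G : countType) (E : rel G).
(* pG i j stands for p_G(i,j) and pb i for p(-i). *)
Variables (pG : G -> G -> R) (pb : G -> R).

Definition stochastic : Prop :=
  (forall i j, 0 <= pG i j) /\
  (forall i, (\esum_(j in [set: G]) (pG i j)%:E = 1)%E).

Definition transition_data : Prop :=
  [/\ strongly_connected E,
      bounded_geometry E,
      stochastic,
      (forall i j, 0 < pG i j <-> E i j) &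
      (exists eps : R, 0 < eps < 1 /\ forall i, eps < pb i < 1 - eps)].

Definition pfwd (i j : G) : R := (1 - pb i) * pG i j.

Definition Mmat (i j : G) : R := pfwd i j / pb i.

Definition ptree (i0 : G) (x y : dcover E i0) : R :=
  if is_child x y then pfwd (dlabel x) (dlabel y)
  else if (x != droot E i0) && (y == danc x) then pb (dlabel x)
  else if (x == droot E i0) && (y == droot E i0) then pb i0
  else 0.

End Transitions.

Section CollatzWielandt.
Variables (R : realType) (G : countType).

(* The sum defining M f is taken in the extended reals, as an unconditional
   sum over the countable set G; its terms are non-negative whenever M and f
   are. *)
Definition mx_act (M : G -> G -> R) (f : G -> R) (x : G) : \bar R :=
  (\esum_(y in [set: G]) (M x y * f y)%:E)%E.

Definition linfty (f : G -> R) : Prop := exists C : R, forall x, `|f x| <= C.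

(* For M with bounded row sums the set below is bounded above, so that [sup]
   is its actual supremum as soon as the set is not empty. *)
Definition upper_CW (M : G -> G -> R) : R :=
  sup [set lam : R | 0 < lam /\
    exists f : G -> R,
      [/\ linfty f, (forall x, 0 <= f x), f <> cst 0 &
          (forall x, ((lam * f x)%:E <= mx_act M f x)%E)]].

End CollatzWielandt.

Section RandomWalk.
Variables (R : realType) (d : measure_display) (Omega : measurableType d).
Variable P : probability Omega R.

(* Measurability is with respect to the discrete sigma-algebra on the
   countable state space T.  The last clause is the Markov property with
   one-step transition probabilities p, multiplied out so as not to condition
   on null events. *)
Definition markov_chain (T : countType) (o : T) (p : T -> T -> R)
    (X : nat -> Omega -> T) : Prop :=
  [/\ (forall n x, measurable (X n @^-1` [set x])),
      P (X 0%N @^-1` [set o]) = 1%E &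
      (forall (n : nat) (x : nat -> T),
        P [set w | forall k, (k <= n.+1)%N -> X k w = x k] =
        (P [set w | forall k, (k <= n)%N -> X k w = x k] *
         (p (x n) (x n.+1))%:E)%E)].

(* Recurrence and transience of a chain started at o: the probability of ever
   returning to o is one, respectively less than one. *)
Definition recurrent (T : countType) (o : T) (X : nat -> Omega -> T) : Prop :=
  P [set w | exists n, X n.+1 w = o] = 1%E.

Definition transient (T : countType) (o : T) (X : nat -> Omega -> T) : Prop :=
  (P [set w | exists n, X n.+1 w = o] < 1)%E.

Definition cover_walk (G : countType) (E : rel G) (i0 : G)
    (pG : G -> G -> R) (pb : G -> R) (X : nat -> Omega -> dcover E i0) : Prop :=
  markov_chain (droot E i0) (@ptree R G E pG pb i0) X.

End RandomWalk.

(* Main.v *)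
(** The matrix M linearises, at h = 0, the fixed point equation
    h = Mh / (1 + Mh) satisfied by h(i), the probability that the walk started
    at a vertex labelled i never visits the direct ancestor of that vertex.
    Transience amounts to a non-zero bounded solution of h <= Mh / (1 + Mh):
    - given such an h, the product of 1 - h over the labels along the path from
      the root is superharmonic off the root, hence bounds the probability of
      hitting the root;
    - conversely, if r is the probability of hitting the root, the supremum h(i)
      of 1 - r(x) / r(x^-) over the vertices x labelled i is such a solution.
    Since h <= Mh / (1 + Mh) implies h <= Mh, transience forces lambda^+(M) >= 1;
    and if Mf >= lambda f with lambda > 1 and f bounded, a small multiple of f is
    a solution, so lambda^+(M) > 1 forces transience.
    At lambda^+(M) = 1, the loop on one vertex with M = 1 is recurrent, and the
    line on the natural numbers with M(i, i+1) = (i+3)/(i+1) and small backward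
    entries is transient, with h(i) = 1/(i+2). *)
Require Import Defs.
From mathcomp Require Import all_boot all_order all_algebra.
From mathcomp Require Import all_classical all_reals all_analysis.
From mathcomp Require Import zify ring lra.
Set Implicit Arguments.
Unset Strict Implicit.
Unset Printing Implicit Defensive.
Import Order.TTheory GRing.Theory Num.Theory.
Import numFieldNormedType.Exports.
Local Open Scope classical_set_scope.
Local Open Scope ring_scope.

(** * Hitting probabilities of a Markov chain *)

Section HittingProbability.
Variables (R : realType) (T : countType) (o : T) (p : T -> T -> R).
Variable nb : T -> seq T.
Hypothesis nb_uniq : forall x, uniq (nb x).
Hypothesis p_ge0 : forall x y, 0 <= p x y.
Hypothesis p_sum1 : forall x, \sum_(y <- nb x) p x y = 1.

(** The probability of visiting [o] at a time at most [n], starting from [x]. The first-step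
    recursion defines it for every [x], while the chain itself only starts at [o]; [hit_withinP]
    connects the two. *)
Fixpoint hit (n : nat) (x : T) : R :=
  if x == o then 1
  else if n is n'.+1 then \sum_(y <- nb x) p x y * hit n' y else 0.

Lemma hit_root n : hit n o = 1.
Proof. by case: n => [|n] /=; rewrite eqxx. Qed.

Lemma hitS n x : x != o -> hit n.+1 x = \sum_(y <- nb x) p x y * hit n y.
Proof. by rewrite /= => /negbTE ->. Qed.

Lemma hit_ge0 n x : 0 <= hit n x.
Proof.
elim: n x => [|n IH] x /=; case: ifP => // _.
by apply: sumr_ge0 => y _; rewrite mulr_ge0.
Qed.

(** Minimality of hitting probabilities: averaging over [p] is monotone, so the bound propagates
    through the first-step recursion. *)
Lemma hit_le_superharmonic (W : T -> R) : (forall x, 0 <= W x) -> 1 <= W o ->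
  (forall x, x != o -> \sum_(y <- nb x) p x y * W y <= W x) ->
  forall n x, hit n x <= W x.
Proof.
move=> W0 Wo Wsup; elim=> [|n IH] x /=; case: eqVneq => [->//|xo] //.
apply: le_trans (Wsup x xo); apply: ler_sum => y _; exact: ler_wpM2l.
Qed.

Lemma hit_le1 n x : hit n x <= 1.
Proof.
apply: (@hit_le_superharmonic (fun=> 1)) => // y _.
by under eq_bigr do rewrite mulr1; rewrite p_sum1.
Qed.

Lemma hit_leS n x : hit n x <= hit n.+1 x.
Proof.
elim: n x => [|n IH] x; have [->|xo] := eqVneq x o; rewrite ?hit_root //.
  by rewrite [leLHS]/= (negbTE xo) hit_ge0.
by rewrite !hitS//; apply: ler_sum => y _; exact: ler_wpM2l.
Qed.

Lemma hit_nondecreasing x : nondecreasing_seq (hit^~ x).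
Proof. by apply/nondecreasing_seqP => n; exact: hit_leS. Qed.

Definition hitoo x : R := sup (range (hit^~ x)).

Lemma cvg_hit x : hit n x @[n --> \oo] --> hitoo x.
Proof.
apply: nondecreasing_cvgn; first exact: hit_nondecreasing.
by exists 1 => _ [n _ <-]; exact: hit_le1.
Qed.

Lemma hit_le_hitoo n x : hit n x <= hitoo x.
Proof.
apply: sup_upper_bound; last by exists n.
split; first by exists (hit 0 x), 0%N.
by exists 1 => _ [k _ <-]; exact: hit_le1.
Qed.

Lemma cvg_sum_hit x :
  \sum_(y <- nb x) p x y * hit n y @[n --> \oo] -->
  \sum_(y <- nb x) p x y * hitoo y.
Proof.
apply: (@cvg_big R^o); first exact: add_continuous.
by move=> y _; apply: cvgMr; exact: cvg_hit.
Qed.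

Lemma hitoo_le1 x : hitoo x <= 1.
Proof.
by apply: ge_sup => [|_ [n _ <-]]; [exists (hit 0 x), 0%N | exact: hit_le1].
Qed.

Lemma hitoo_root : hitoo o = 1.
Proof.
by apply/eqP; rewrite eq_le hitoo_le1 -{1}(hit_root 0) hit_le_hitoo.
Qed.

Lemma hitoo_ge0 x : 0 <= hitoo x.
Proof. exact: le_trans (hit_ge0 0 x) (hit_le_hitoo 0 x). Qed.

Lemma hitoo_superharmonic x : x != o ->
  \sum_(y <- nb x) p x y * hitoo y <= hitoo x.
Proof.
move=> xo; apply: (ler_cvg_to (@cvg_sum_hit x) (cvg_cst (hitoo x))).
by apply: nearW => n; rewrite -hitS//; exact: hit_le_hitoo.
Qed.

(** * Return probability of a chain in terms of hitting probabilities *)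

Section ReturnProbability.
Context d (Omega : measurableType d) (P : probability Omega R).
Variable X : nat -> Omega -> T.
Hypothesis X_markov : markov_chain P o p X.

Let mX n x : measurable (X n @^-1` [set x]).
Proof. by case: X_markov. Qed.

Let PDI A B : measurable A -> measurable B ->
  (P A = P (A `\` B) + P (A `&` B))%E.
Proof. exact: measureDI. Qed.

Definition cylinder (m : nat) (x : nat -> T) : set Omega :=
  [set w | forall k, (k <= m)%N -> X k w = x k].

(** The time offset [m] plays the part of a shift of the chain, so that the induction on [n] can
    condition on the next step. *)
Definition hit_within (m n : nat) : set Omega :=
  [set w | exists k, (k <= n)%N /\ X (m + k) w = o].

Lemma measurable_cylinder m x : measurable (cylinder m x).
Proof.
rewrite (_ : cylinder m x = \bigcap_(k in `I_m.+1) (X k @^-1` [set x k])).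
  by apply: bigcap_measurable => [|k _]; [exists 0%N | exact: mX].
by [].
Qed.

Lemma measurable_hit_within m n : measurable (hit_within m n).
Proof.
rewrite (_ : hit_within m n = \bigcup_(k in `I_n.+1) (X (m + k) @^-1` [set o])).
  by apply: bigcup_measurable => k _; exact: mX.
by apply/seteqP; split=> [w [k [kn wk]]|w [k kn wk]]; exists k.
Qed.

Let upd (x : nat -> T) m y : nat -> T := fun k => if k == m then y else x k.

Let cylinder_upd m x y :
  cylinder m x `&` X m.+1 @^-1` [set y] = cylinder m.+1 (upd x m.+1 y).
Proof.
rewrite /upd; apply/seteqP; split=> [w [wx wy] k|w wx].
  rewrite leq_eqVlt => /orP[/eqP ->|km]; first by rewrite eqxx.
  by rewrite ltn_eqF// wx.
split=> [k km|]; last by have := wx _ (leqnn _); rewrite eqxx.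
by have := wx k (leqW km); rewrite ltn_eqF.
Qed.

Lemma cylinder_step m x y : P (cylinder m x `&` X m.+1 @^-1` [set y]) =
  (P (cylinder m x) * (p (x m) y)%:E)%E.
Proof.
rewrite cylinder_upd; have [_ _ ->] := X_markov.
rewrite /upd eqxx ltn_eqF//; congr (P _ * _)%E.
apply/seteqP; split=> w wx k km; have := wx k km; rewrite ltn_eqF//.
Qed.

(* As the p (x m) y with y in nb (x m) sum to one, jumping outside nb is a null
   event: finite additivity suffices. *)
Lemma measure_cylinder_split m x B : measurable B -> B `<=` cylinder m x ->
  P B = (\sum_(y <- nb (x m)) P (B `&` X m.+1 @^-1` [set y]))%E.
Proof.
move=> mB BS; set N := [set` nb (x m)].
set U := \bigcup_(y in N) X m.+1 @^-1` [set y].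
have finN : finite_set N by exact: finite_seq.
have mU : measurable U by apply: fin_bigcup_measurable => // y _; exact: mX.
have split_U A : measurable A ->
    P (A `&` U) = (\sum_(y <- nb (x m)) P (A `&` X m.+1 @^-1` [set y]))%E.
  move=> mA; rewrite /U setI_bigcupr measure_fin_bigcup//.
  - by rewrite -fsbig_seq.
  - by move=> y z _ _ [w [[_ <-] [_ <-]]].
  - by move=> y _; apply: measurableI => //; exact: mX.
have mS := measurable_cylinder m x.
have PSU : P (cylinder m x `&` U) = P (cylinder m x).
  rewrite split_U//; under eq_bigr do rewrite cylinder_step.
  rewrite -ge0_sume_distrr; last by move=> y _; rewrite lee_fin.
  by rewrite sumEFin p_sum1 mule1.
have finS : P (cylinder m x) \is a fin_num by rewrite fin_num_measure.
have PSDU : P (cylinder m x `\` U) = 0.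
  by rewrite -[LHS](addeK _ finS) -{1}PSU -PDI// subee.
rewrite -split_U// (PDI mB mU).
have -> : P (B `\` U) = 0; last by rewrite add0e.
apply: subset_measure0 PSDU; [exact: measurableD|exact: measurableD|].
by move=> w [/BS].
Qed.

(** Markov property at time [m]: given the past, the future visits depend on [x m] alone. The
    induction splits the cylinder according to the value at time [m.+1]. *)
Lemma hit_withinP m x n :
  P (cylinder m x `&` hit_within m n) = (P (cylinder m x) * (hit n (x m))%:E)%E.
Proof.
elim: n m x => [|n IH] m x; have [xo|xo] := eqVneq (x m) o.
- rewrite xo hit_root mule1; congr (P _); apply/setIidPl => w wx.
  by exists 0%N; rewrite addn0 wx.
- rewrite /= (negbTE xo) mule0 (_ : _ `&` _ = set0) ?measure0//.
  rewrite -subset0 => w [wx [k []]]; rewrite leqn0 => /eqP ->.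
  by rewrite addn0 wx// => /eqP; rewrite (negbTE xo).
- rewrite xo hit_root mule1; congr (P _); apply/setIidPl => w wx.
  by exists 0%N; rewrite addn0 wx.
rewrite (measure_cylinder_split (m := m) (x := x)); last 2 first.
- by apply: measurableI; [exact: measurable_cylinder|exact: measurable_hit_within].
- by move=> w [].
rewrite hitS// -sumEFin ge0_sume_distrr; last first.
  by move=> y _; rewrite lee_fin mulr_ge0 ?hit_ge0.
apply: eq_bigr => y _; rewrite EFinM muleA -cylinder_step.
have := IH m.+1 (upd x m.+1 y); rewrite -cylinder_upd {1}/upd eqxx => <-.
(* Since [x m] is not [o], a visit at offset 0 is impossible; offsets counted from [m] and from
   [m.+1] differ by one. *)
congr (P _); rewrite [in LHS]setIAC; apply/seteqP; split=> w [wx [k [kn wk]]].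
  split=> //; exists k.-1; case: k kn wk => [|k] kn wk.
    by move: wk; rewrite addn0 (proj1 wx)// => /eqP; rewrite (negbTE xo).
  by rewrite addSnnS.
by split=> //; exists k.+1; rewrite -addSnnS.
Qed.

Lemma return_withinP n :
  P (hit_within 1 n) = (\sum_(y <- nb o) p o y * hit n y)%:E.
Proof.
have [_ X0 _] := X_markov.
have cylE : cylinder 0 (fun=> o) = X 0 @^-1` [set o].
  apply/seteqP; split=> [w /(_ 0)//|w wo k]; first exact.
  by rewrite leqn0 => /eqP ->.
have mW := measurable_hit_within 1 n.
(* The chain starts at [o] only almost surely, so the event is first restricted to [X 0 = o]. *)
have -> : P (hit_within 1 n) = P (cylinder 0 (fun=> o) `&` hit_within 1 n).
  rewrite (PDI mW (mX 0 o)) [_ `&` hit_within _ _]setIC -cylE.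
  have -> : P (hit_within 1 n `\` cylinder 0 (fun=> o)) = 0; last by rewrite add0e.
  have mC := measurable_cylinder 0 (fun=> o).
  have PC0 : P (~` cylinder 0 (fun=> o)) = 0.
    by rewrite probability_setC// cylE X0 subee.
  by apply: subset_measure0 PC0;
    [exact: measurableD|exact: measurableC|move=> w []].
rewrite (measure_cylinder_split (m := 0) (x := fun=> o)); last 2 first.
- by apply: measurableI => //; exact: measurable_cylinder.
- by move=> w [].
rewrite -sumEFin; apply: eq_bigr => y _.
rewrite setIAC cylinder_upd hit_withinP -cylinder_upd cylinder_step cylE X0.
by rewrite mul1e /upd eqxx EFinM.
Qed.

Let returnE :
  [set w | exists n, X n.+1 w = o] = \bigcup_n hit_within 1 n.
Proof.
apply/seteqP; split=> [w [n wn]|w [n _ [k [_ wk]]]]; last by exists k.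
by exists n => //; exists n.
Qed.

(** The return event is the increasing union of the [hit_within 1 n]; continuity from below carries
    over the bound on each [hit n]. *)
Lemma return_prob_le (W : T -> R) : (forall x, 0 <= W x) -> 1 <= W o ->
  (forall x, x != o -> \sum_(y <- nb x) p x y * W y <= W x) ->
  (P [set w | exists n, X n.+1 w = o] <= (\sum_(y <- nb o) p o y * W y)%:E)%E.
Proof.
move=> W0 Wo Wsup; rewrite returnE.
have : (P \o hit_within 1) n @[n --> \oo] --> P (\bigcup_n hit_within 1 n).
  apply: nondecreasing_cvg_mu => [n||m n mn].
  - exact: measurable_hit_within.
  - by apply: bigcup_measurable => n _; exact: measurable_hit_within.
  - apply/subsetPset => w [k [km wk]]; exists k; split=> //.
    exact: leq_trans mn.
move/cvge_to_le; apply; apply: nearW => n /=; rewrite return_withinP lee_fin.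
by apply: ler_sum => y _; apply: ler_wpM2l => //; exact: hit_le_superharmonic.
Qed.

Lemma return_prob_ge :
  ((\sum_(y <- nb o) p o y * hitoo y)%:E <=
    P [set w | exists n, X n.+1 w = o])%E.
Proof.
rewrite returnE.
have mret : measurable (\bigcup_n hit_within 1 n).
  by apply: bigcup_measurable => n _; exact: measurable_hit_within.
have finP : P (\bigcup_n hit_within 1 n) \is a fin_num by rewrite fin_num_measure.
rewrite -(fineK finP) lee_fin.
apply: (ler_cvg_to (@cvg_sum_hit o) (cvg_cst _)); apply: nearW => n.
rewrite -lee_fin fineK// -return_withinP; apply: le_measure; rewrite ?inE//.
  exact: measurable_hit_within.
by move=> w; exists n.
Qed.

Lemma recurrent_of_hitoo : (forall y, y \in nb o -> hitoo y = 1) ->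
  recurrent P o X.
Proof.
move=> r1; apply/eqP; rewrite eq_le probability_le1 ?andTb; last first.
  rewrite returnE.
  by apply: bigcup_measurable => n _; exact: measurable_hit_within.
apply: le_trans return_prob_ge; rewrite lee_fin -(p_sum1 o) big_seq [leRHS]big_seq.
by apply: ler_sum => y yo; rewrite r1// mulr1.
Qed.

End ReturnProbability.

End HittingProbability.

(** * Existence of Markov chains on the unit interval *)

Section ChainExistence.
Variables (R : realType) (T : countType) (o : T) (p c : T -> T -> R).
Variable next : T -> R -> T.
Hypothesis p_ge0 : forall x y, 0 <= p x y.
Hypothesis c_ge0 : forall x y, 0 <= c x y.
Hypothesis cp_le1 : forall x y, c x y + p x y <= 1.
(* From x, the step to y is driven by the subinterval [c x y, c x y + p x y[ of
   [0, 1[, which is then rescaled to [0, 1[ to drive the next steps. *)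
Hypothesis nextP : forall x y (u : R), 0 <= u < 1 ->
  (next x u = y <-> c x y <= u < c x y + p x y).

Definition drive (su : T * R) : T * R :=
  let y := next su.1 su.2 in (y, (su.2 - c su.1 y) / p su.1 y).

Definition driven (x : T) (u : R) (n : nat) : T := (iter n drive (x, u)).1.

Lemma driven0 x u : driven x u 0 = x. Proof. by []. Qed.

Lemma drivenS x u n : driven x u n.+1 =
  driven (next x u) ((u - c x (next x u)) / p x (next x u)) n.
Proof. by rewrite /driven iterSr. Qed.

(** The points following a prescribed path form a half-open interval whose length is the product of
    the transition probabilities: each step pulls the interval of the remaining path back along the
    affine map [v -> (v - c) / p]. *)
Lemma driven_cylinder n (x : nat -> T) : exists a, forall u,
  (0 <= u < 1 /\ (forall k, (k <= n)%N -> driven (x 0) u k = x k)) <->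
  a <= u < a + \prod_(k < n) p (x k) (x k.+1).
Proof.
elim: n x => [|n IH] x.
  exists 0 => u; rewrite big_ord0 add0r; split=> [[]//|u01]; split=> // k.
  by rewrite leqn0 => /eqP ->.
have [a aP] := IH (fun k => x k.+1).
exists (c (x 0) (x 1) + p (x 0) (x 1) * a) => u.
rewrite big_ord_recl /= -addrA -mulrDr.
set q := p (x 0) (x 1); set c0 := c (x 0) (x 1).
set w := \prod_(k < n) _ in aP *.
have step v : 0 <= v < 1 -> next (x 0) v = x 1 -> forall k,
    driven (x 0) v k.+1 = driven (x 1) ((v - c0) / q) k.
  by move=> _ vx k; rewrite drivenS vx.
(* With [q = 0] the rescaling divides by zero, but both sides are then empty. *)
have [q0|q_neq0] := eqVneq q 0.
  split=> [[u01 ux]|]; last by rewrite q0 !mul0r addr0; lra.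
  have /(nextP _ _ u01) : next (x 0) u = x 1 by rewrite -(ux 1).
  by rewrite -/q q0 -/c0 addr0; lra.
have q0 : 0 < q by rewrite lt_neqAle eq_sym q_neq0 p_ge0.
have scale v : (a <= (v - c0) / q < a + w) = (c0 + q * a <= v < c0 + q * (a + w)).
  by rewrite ler_pdivlMr// ltr_pdivrMr// lerBrDl ltrBlDl ![_ * q]mulrC.
have scale01 v : (0 <= (v - c0) / q < 1) = (c0 <= v < c0 + q).
  by rewrite ler_pdivlMr// ltr_pdivrMr// mul0r mul1r lerBrDl ltrBlDl addr0.
rewrite -scale; split=> [[u01 ux]|/aP[u01' ux]].
  have ux1 : next (x 0) u = x 1 by rewrite -(ux 1).
  apply/aP; split; first by rewrite scale01; apply/nextP.
  by move=> k kn; rewrite -step// ux.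
have u01 : 0 <= u < 1.
  move: u01'; rewrite scale01; have := c_ge0 (x 0) (x 1).
  have := cp_le1 (x 0) (x 1); rewrite -/q -/c0; lra.
split=> // -[//|k] kn; rewrite step// ?ux//.
by apply/nextP => //; rewrite -/c0 -/q -scale01.
Qed.

Local Notation D := (`[0%R, 1%R[%classic : set R).

Let Pu : probability _ R := uniform_prob (@ltr01 R).

Let Pu_itv (a w : R) : 0 <= w -> (forall u, a <= u < a + w -> 0 <= u < 1) ->
  Pu `[a, (a + w)%R[%classic = w%:E.
Proof.
move=> w0 aw; rewrite /Pu /= /uniform_prob integral_uniform_pdf.
have sub01 : `[a, (a + w)%R[ `<=` (`[0%R, 1%R]%classic : set R).
  by move=> u; rewrite /= !in_itv /= => /aw/andP[-> /ltW ->].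
rewrite setIidl// (eq_integral (cst 1%E)); last first.
  move=> u; rewrite inE => /sub01; rewrite /= in_itv /= /uniform_pdf => ->.
  by rewrite subr0 invr1.
rewrite integral_cst//= mul1e.
rewrite lebesgue_measure_itv /= lte_fin; case: ltP => [_|].
  by rewrite -EFinB addrAC subrr add0r.
by rewrite gerDl => w0'; congr (_%:E); apply/eqP; rewrite eq_le w0.
Qed.

(** Outside [[0, 1[], a null set, the trajectory is constant at [o]; hence [X 0] is [o]
    everywhere. *)
Let X (n : nat) (u : R) : T := if 0 <= u < 1 then driven o u n else o.

Let X_cylinder n x : x 0%N = o -> exists a,
  D `&` [set u | forall k, (k <= n)%N -> X k u = x k] =
  `[a, (a + \prod_(k < n) p (x k) (x k.+1))%R[%classic.
Proof.
move=> xo; have [a aP] := driven_cylinder n x; exists a.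
apply/seteqP; split=> u; rewrite /= !in_itv/=.
  move=> [u01 ux]; apply/aP; split=> // k kn.
  by rewrite xo -[RHS]ux// /X u01.
by move=> /aP[u01 ux]; split=> // k kn; rewrite /X u01 -xo ux.
Qed.

Let mD : measurable D. Proof. exact: measurable_itv. Qed.

Let PuD A : measurable A -> Pu A = Pu (D `&` A).
Proof.
move=> mA.
have PuD1 : Pu D = 1%E.
  by have := @Pu_itv 0 1 ler01; rewrite add0r; apply.
have PuDC : Pu (~` D) = 0 by rewrite probability_setC// PuD1 subee.
have PDI B : measurable B -> (Pu B = Pu (B `\` D) + Pu (B `&` D))%E.
  by move=> mB; exact: measureDI.
rewrite PDI// setIC (_ : Pu (A `\` D) = 0) ?add0e//.
by apply: subset_measure0 PuDC;
  [exact: measurableD|exact: measurableC|move=> w []].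
Qed.

(** As [T] is countable, there are countably many finite paths; within [D] the event is the union of
    the intervals of those from [o] that reach [x] at time [n]. *)
Let measurable_X n x : measurable (X n @^-1` [set x]).
Proof.
rewrite -(setUIDK (X n @^-1` [set x]) D); apply: measurableU; last first.
  have [xo|xo] := eqVneq o x; last first.
    rewrite (_ : _ `\` _ = set0)// -subset0 => u [+ /negP].
    by rewrite /X /= in_itv /= => + /negbTE u01; rewrite u01 => /eqP; exact/negP.
  rewrite (_ : _ `\` _ = ~` D); first exact: measurableC.
  rewrite setDE setIidr// => u /negP.
  by rewrite /X /= in_itv /= => /negbTE ->.
rewrite (_ : _ `&` _ = \bigcup_(s : seq T)
    if (nth o s 0 == o) && (nth o s n == x)
    then D `&` [set u | forall k, (k <= n)%N -> X k u = nth o s k] else set0).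
  apply: countable_bigcupT_measurable => // s; case: ifP => // /andP[/eqP so _].
  by have [a ->] := @X_cylinder n (nth o s) so; exact: measurable_itv.
apply/seteqP; split=> [u [ux u01]|u [s _]].
  exists (mkseq (X^~ u) n.+1) => //.
  have X0 : X 0%N u = o by rewrite /X if_same.
  rewrite !nth_mkseq// X0 eqxx ux eqxx; split=> // k kn.
  by rewrite nth_mkseq.
by case: ifP => // /andP[_ /eqP sx] [u01 us]; split=> //=; rewrite us.
Qed.

Lemma markov_chain_exists : exists (d : measure_display)
  (Omega : measurableType d) (P : probability Omega R) (X : nat -> Omega -> T),
  markov_chain P o p X.
Proof.
have cyl_prob n x : x 0%N = o ->
    Pu [set u | forall k, (k <= n)%N -> X k u = x k] =
    (\prod_(k < n) p (x k) (x k.+1))%:E.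
  move=> xo; have [a aE] := @X_cylinder n x xo.
  rewrite PuD ?aE ?Pu_itv ?prodr_ge0//.
    move=> u ux; have : D u; last by rewrite /= in_itv.
    suff : (`[a, (a + \prod_(k < n) p (x k) (x k.+1))%R[%classic : set R) u.
      by rewrite -aE => -[].
    by rewrite /= in_itv.
  rewrite (_ : [set u | _] = \bigcap_(k in `I_n.+1) (X k @^-1` [set x k])).
    by apply: bigcap_measurable => [|k _]; [exists 0%N|exact: measurable_X].
  by [].
exists _, _, Pu, X; split.
- exact: measurable_X.
- have := cyl_prob 0%N (fun=> o) erefl; rewrite big_ord0 => <-; congr (Pu _).
  by apply/seteqP; split=> [u uo k|u /(_ 0%N (leqnn _))//]; rewrite leqn0 => /eqP ->.
- move=> n x; have [xo|xo] := eqVneq (x 0%N) o.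
    by rewrite !cyl_prob// big_ord_recr EFinM.
  have cyl0 m : [set u | forall k, (k <= m)%N -> X k u = x k] = set0.
    rewrite -subset0 => u /(_ 0%N isT)/eqP; rewrite /X driven0 if_same eq_sym.
    by rewrite (negbTE xo).
  by rewrite !cyl0 measure0 mul0e.
Qed.

End ChainExistence.

(** * The walk on a directed cover *)

Lemma esum_seq (R : realType) (T : choiceType) (s : seq T) (a : T -> R) :
  uniq s -> (forall x, 0 <= a x) -> (forall x, x \notin s -> a x = 0) ->
  (\esum_(x in [set: T]) (a x)%:E = (\sum_(x <- s) a x)%:E)%E.
Proof.
move=> us a0 as0; rewrite (esumID [set` s]); last by move=> x _; rewrite lee_fin.
rewrite !setTI [X in (_ + X)%E]esum1 ?adde0; last first.
  by move=> x /= /negP xs; rewrite as0.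
rewrite esum_fset; first last.
- by move=> x _; rewrite lee_fin.
- exact: finite_seq.
by rewrite -fsbig_seq// sumEFin.
Qed.

(** Consecutive intervals of lengths [w x] are laid from [b] along [s]: [selc.1] sends a point to
    the index of its interval and [selc.2] gives the left endpoints. Past the end of the list the
    selector returns [x0]. *)
Lemma partition_itv (R : realType) (T : eqType) (x0 : T) (s : seq T) (w : T -> R)
    (b : R) : uniq s -> (forall x, 0 <= w x) ->
  exists selc : (R -> T) * (T -> R),
    (forall x, x \in s ->
       b <= selc.2 x /\ selc.2 x + w x <= b + \sum_(y <- s) w y) /\
    (forall u, b <= u < b + \sum_(y <- s) w y -> selc.1 u \in s /\
       forall x, x \in s -> selc.1 u = x <-> selc.2 x <= u < selc.2 x + w x).
Proof.
move=> + w0; elim: s b => [b _|x s IH b /= /andP[xs us]].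
  by exists (fun=> x0, fun=> 0); split=> // u; rewrite big_nil addr0 => /andP[]; lra.
have [[sel c] /= [c_bnd selP]] := IH (b + w x) us.
exists (fun u => if u < b + w x then x else sel u, fun y => if y == x then b else c y).
have sum0 : 0 <= \sum_(y <- s) w y by apply: sumr_ge0.
split=> /= [y|u]; rewrite big_cons addrA.
  rewrite inE; case: eqVneq => [->|_] /=; first by rewrite lexx lerDl.
  by move=> /c_bnd[]; have := w0 x; lra.
move=> /andP[bu us1]; case: ltP => [ux|ux].
  split=> [|y]; first by rewrite mem_head.
  rewrite inE; case: eqVneq => [->|yx] /= ys; first by rewrite bu ux.
  split=> [xy|]; first by rewrite xy eqxx in yx.
  by move=> /andP[cu _]; have [cy _] := c_bnd y ys; exfalso; lra.
have [selu selE] := selP u (introT andP (conj ux us1)).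
split=> [|y]; first by rewrite inE selu orbT.
rewrite inE; case: eqVneq => [->|yx] /= ys; last exact: selE.
split=> [ux'|]; last by move=> /andP[_ ux']; exfalso; lra.
by move: xs; rewrite -ux' selu.
Qed.

Section CoverWalk.
Variables (R : realType) (G : countType) (E : rel G) (i0 : G).
Variables (pG : G -> G -> R) (pb : G -> R).
Hypothesis data : transition_data E pG pb.
Local Notation M := (Mmat pG pb).
Local Notation cover := (dcover E i0).
Local Notation root := (droot E i0).
Local Notation fwd := (pfwd pG pb).

(** Bounded geometry turns every sum over successors, and hence the action of [M], into a finite
    sum. *)
Let succ_finite i : finite_set [set j | E i j].
Proof.
have [_ [D /(_ i)[+ _]] _ _ _] := data.
by move/card_le_finite; apply; exact: finite_II.
Qed.

Definition succs (i : G) : seq G := finmap.enum_fset (fset_set [set j | E i j]).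

Lemma mem_succs i j : (j \in succs i) = E i j.
Proof. by rewrite /succs in_fset_set// mem_setE. Qed.

Lemma succs_uniq i : uniq (succs i).
Proof. exact: finmap.fset_uniq. Qed.

Lemma pb_bounds i : 0 < pb i < 1.
Proof.
have [_ _ _ _ [e [/andP[e0 e1] /(_ i)/andP[h1 h2]]]] := data.
by apply/andP; split; lra.
Qed.

Lemma pb_gt0 i : 0 < pb i. Proof. by have /andP[] := pb_bounds i. Qed.

Lemma pG_ge0 i j : 0 <= pG i j.
Proof. by have [_ _ [+ _] _ _] := data. Qed.

Lemma pG_notin i j : j \notin succs i -> pG i j = 0.
Proof.
have [_ _ _ pE _] := data; rewrite mem_succs => nE.
apply/eqP; rewrite eq_le pG_ge0 andbT leNgt.
by apply/negP => /pE; exact/negP.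
Qed.

Lemma pG_sum i : \sum_(j <- succs i) pG i j = 1.
Proof.
have [_ _ [_ /(_ i)+] _ _] := data.
rewrite (@esum_seq _ _ (succs i)) ?succs_uniq//; first by case.
- exact: pG_ge0.
- exact: pG_notin.
Qed.

Lemma pfwd_ge0 i j : 0 <= fwd i j.
Proof.
have /andP[_ b1] := pb_bounds i.
by rewrite mulr_ge0 ?pG_ge0// subr_ge0 ltW.
Qed.

Lemma pfwd_sum i : \sum_(j <- succs i) fwd i j = 1 - pb i.
Proof. by rewrite -mulr_sumr pG_sum mulr1. Qed.

Lemma Mmat_ge0 i j : 0 <= M i j.
Proof. by rewrite divr_ge0 ?pfwd_ge0// ltW// pb_gt0. Qed.

Lemma Mmat_gt0 i j : E i j -> 0 < M i j.
Proof.
have [_ _ _ pE _] := data; move=> /pE pij.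
have /andP[b0 b1] := pb_bounds i.
by rewrite divr_gt0// mulr_gt0// subr_gt0.
Qed.

Definition Mact (f : G -> R) (i : G) : R := \sum_(j <- succs i) M i j * f j.

Lemma mx_actE f i : (forall j, 0 <= f j) -> mx_act M f i = (Mact f i)%:E.
Proof.
move=> f0; apply: esum_seq; first exact: succs_uniq.
  by move=> j; rewrite mulr_ge0 ?Mmat_ge0.
by move=> j /pG_notin pij; rewrite /Mmat /pfwd pij mulr0 !mul0r.
Qed.

Lemma Mact_ge0 f i : (forall j, 0 <= f j) -> 0 <= Mact f i.
Proof. by move=> f0; apply: sumr_ge0 => j _; rewrite mulr_ge0 ?Mmat_ge0. Qed.

Lemma le_Mact f g i : (forall j, f j <= g j) -> Mact f i <= Mact g i.
Proof. by move=> fg; apply: ler_sum => j _; rewrite ler_wpM2l ?Mmat_ge0. Qed.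

Lemma MactZ a f i : Mact (fun j => a * f j) i = a * Mact f i.
Proof. by rewrite /Mact mulr_sumr; apply: eq_bigr => j _; rewrite mulrCA. Qed.

Lemma pfwd_Mact f i : \sum_(j <- succs i) fwd i j * f j = pb i * Mact f i.
Proof.
rewrite /Mact mulr_sumr; apply: eq_bigr => j _.
by rewrite /Mmat mulrA [pb i * _]mulrC divfK// gt_eqF// pb_gt0.
Qed.

Lemma Mact_gt0 f i j : (forall j, 0 <= f j) -> E i j -> 0 < f j -> 0 < Mact f i.
Proof.
move=> f0 ij fj; rewrite /Mact (big_rem j) ?mem_succs//=.
apply: ltr_pwDl; first by rewrite mulr_gt0 ?Mmat_gt0.
by apply: sumr_ge0 => k _; rewrite mulr_ge0 ?Mmat_ge0.
Qed.

(** The row sums of [M] are [(1 - pb i) / pb i], at most the inverse of the uniform lower bound on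
    [pb]. *)
Lemma Mact_bounded : exists2 K : R, 0 < K &
  forall f C, 0 <= C -> (forall j, f j <= C) -> forall i, Mact f i <= K * C.
Proof.
have [_ _ _ _ [e [/andP[e0 e1] be]]] := data.
exists e^-1; rewrite ?invr_gt0// => f C C0 fC i.
apply: (@le_trans _ _ (Mact (fun=> C * 1) i)).
  by apply: le_Mact => j; rewrite mulr1.
rewrite MactZ mulrC ler_wpM2r//.
have /andP[b0 b1] := pb_bounds i; have /andP[eb _] := be i.
have -> : Mact (fun=> 1) i = (1 - pb i) / pb i.
  rewrite -pfwd_sum mulr_suml; apply: eq_bigr => j _; exact: mulr1.
rewrite ler_pdivrMr// (@le_trans _ _ 1)//; first lra.
by rewrite ler_pdivlMl// mulr1 ltW.
Qed.

(** Meaningful along edges; for other [j] the default value is [x] itself. *)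
Definition child (x : cover) (j : G) : cover := insubd x (rcons (sval x) j).

Lemma val_child (x : cover) j : E (dlabel x) j -> sval (child x j) = rcons (sval x) j.
Proof. by move=> xj; rewrite val_insubd rcons_path (svalP x) xj. Qed.

Lemma dlabel_child (x : cover) j : E (dlabel x) j -> dlabel (child x j) = j.
Proof. by move=> xj; rewrite /dlabel val_child// last_rcons. Qed.

Lemma is_child_child (x : cover) j : E (dlabel x) j -> is_child x (child x j).
Proof. by move=> xj; rewrite is_childE val_child// dlabel_child. Qed.

Lemma danc_child (x : cover) j : E (dlabel x) j -> danc (child x j) = x.
Proof. by move=> /is_child_child/andP[_ /eqP]. Qed.

Lemma is_child_danc (x : cover) : is_child x (danc x) = false.
Proof.
apply/negP; rewrite is_childE => /eqP/(congr1 size)/=.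
by rewrite size_take size_rcons; case: ltnP; lia.
Qed.

(** This includes the root: there [danc] is the identity and the added loop has weight [pb i0]. The
    list [tree_nbrs] thus treats all vertices alike. *)
Lemma ptree_danc (x : cover) : ptree pG pb x (danc x) = pb (dlabel x).
Proof.
rewrite /ptree is_child_danc eqxx andbT; case: eqVneq => //= ->.
rewrite (_ : danc root = root) ?eqxx//; exact: val_inj.
Qed.

Lemma ptree_child (x : cover) j : E (dlabel x) j ->
  ptree pG pb x (child x j) = fwd (dlabel x) j.
Proof. by move=> xj; rewrite /ptree is_child_child// dlabel_child. Qed.

Lemma ptree_ge0 (x y : cover) : 0 <= ptree pG pb x y.
Proof.
rewrite /ptree; do !case: ifP => _ //; rewrite ?pfwd_ge0// ltW//; exact: pb_gt0.
Qed.

Definition tree_nbrs (x : cover) : seq cover :=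
  danc x :: [seq child x j | j <- succs (dlabel x)].

Lemma tree_nbrs_uniq (x : cover) : uniq (tree_nbrs x).
Proof.
rewrite /= map_inj_in_uniq ?succs_uniq ?andbT.
  apply/negP => /mapP[j]; rewrite mem_succs => /is_child_child + xj.
  by rewrite -xj is_child_danc.
move=> j k; rewrite !mem_succs => xj xk /(congr1 (@dlabel G E i0)).
by rewrite !dlabel_child.
Qed.

Lemma sum_tree_nbrs (x : cover) (W : cover -> R) :
  \sum_(y <- tree_nbrs x) ptree pG pb x y * W y =
  pb (dlabel x) * W (danc x) +
  \sum_(j <- succs (dlabel x)) fwd (dlabel x) j * W (child x j).
Proof.
rewrite big_cons big_map ptree_danc; congr (_ + _).
rewrite big_seq [RHS]big_seq; apply: eq_bigr => j; rewrite mem_succs => xj.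
by rewrite ptree_child.
Qed.

Lemma ptree_sum1 (x : cover) : \sum_(y <- tree_nbrs x) ptree pG pb x y = 1.
Proof.
transitivity (\sum_(y <- tree_nbrs x) ptree pG pb x y * (fun=> 1) y).
  by apply: eq_bigr => y _; rewrite mulr1.
rewrite sum_tree_nbrs mulr1; under eq_bigr do rewrite mulr1.
by rewrite pfwd_sum addrCA subrr addr0.
Qed.

(* A bounded solution h of h <= Mh / (1 + Mh): in the largest one, h i is the
   probability that the walk started at a vertex labelled i never visits its
   direct ancestor. *)
Definition escape_bound (h : G -> R) : Prop :=
  (forall i, 0 <= h i <= 1) /\ (forall i, h i * (1 + Mact h i) <= Mact h i).

(** * Transience and recurrence criteria in terms of escape bounds *)

Section Walk.
Context d (Omega : measurableType d) (P : probability Omega R).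
Variable X : nat -> Omega -> cover.
Hypothesis X_walk : cover_walk P pG pb X.

Lemma transient_of_escape_bound h : escape_bound h -> 0 < Mact h i0 ->
  transient P root X.
Proof.
move=> [h01 hM] Mh0.
(* Paths are stored without [i0], so the root contributes no factor and [W root = 1]. One step from
   the root, [W] has mean [1 - pb i0 * Mact h i0 < 1]. *)
pose W (x : cover) : R := \prod_(j <- sval x) (1 - h j).
have W0 x : 0 <= W x.
  by apply: prodr_ge0 => j _; rewrite subr_ge0; case/andP: (h01 j).
have Wroot : W root = 1 by rewrite /W big_nil.
have Wchild (x : cover) j : E (dlabel x) j -> W (child x j) = W x * (1 - h j).
  by move=> xj; rewrite /W val_child// -cats1 big_cat big_seq1.
have sumW (x : cover) : \sum_(j <- succs (dlabel x)) fwd (dlabel x) j * W (child x j) =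
    W x * (1 - pb (dlabel x) * (1 + Mact h (dlabel x))).
  transitivity (\sum_(j <- succs (dlabel x))
      (W x * fwd (dlabel x) j - W x * (fwd (dlabel x) j * h j))).
    rewrite big_seq [RHS]big_seq; apply: eq_bigr => j; rewrite mem_succs => xj.
    by rewrite Wchild//; ring.
  by rewrite sumrB -mulr_sumr pfwd_sum -mulr_sumr pfwd_Mact; ring.
have W_danc x : x != root -> W x = W (danc x) * (1 - h (dlabel x)).
  rewrite /W /dlabel /=; case: x => [s ps] /=; case/lastP: s ps => [|s k] ps.
    by rewrite -val_eqE.
  move=> _; rewrite size_rcons last_rcons /= -cats1 take_size_cat//.
  by rewrite big_cat big_seq1.
have Wsup x : x != root -> \sum_(y <- tree_nbrs x) ptree pG pb x y * W y <= W x.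
  move=> xr; rewrite sum_tree_nbrs sumW (W_danc _ xr); set i := dlabel x.
  rewrite [leLHS](_ : _ = W (danc x) * (pb i + (1 - h i) * (1 - pb i * (1 + Mact h i))));
    last ring.
  (* Without the factor [W (danc x)], the claim is [pb <= (1 - h) * pb * (1 + Mh)], which is
     [h * (1 + Mh) <= Mh] multiplied by [pb]. *)
  apply: ler_wpM2l => //.
  have : pb i * (h i * (1 + Mact h i)) <= pb i * Mact h i.
    by apply: ler_wpM2l => //; rewrite ltW// pb_gt0.
  nra.
apply: le_lt_trans (return_prob_le tree_nbrs_uniq ptree_ge0 ptree_sum1 X_walk W0 _ Wsup) _.
  by rewrite Wroot.
rewrite lte_fin sum_tree_nbrs sumW (_ : danc root = root) ?Wroot; last exact: val_inj.
have := mulr_gt0 (pb_gt0 i0) Mh0; rewrite dlabel_root; lra.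
Qed.

(** The supremum of [1 - r x / r (danc x)] over each label is an escape bound, hence zero; so [r]
    does not decrease from the root to its children, and equals 1 there. *)
Lemma recurrent_of_escape_bound : (forall h, escape_bound h -> forall i, h i = 0) ->
  recurrent P root X.
Proof.
move=> h_eq0.
pose r := hitoo root (@ptree R G E pG pb i0) tree_nbrs.
have r_root : r root = 1 by apply: hitoo_root ptree_sum1; exact: ptree_ge0.
have r0 x : 0 <= r x by apply: hitoo_ge0 ptree_sum1 _; exact: ptree_ge0.
have r_sup (x : cover) : x != root -> pb (dlabel x) * r (danc x) +
    \sum_(j <- succs (dlabel x)) fwd (dlabel x) j * r (child x j) <= r x.
  move=> xr; rewrite -sum_tree_nbrs.
  exact: (hitoo_superharmonic ptree_ge0 ptree_sum1).
(* Stepping straight back to the ancestor has positive probability at every depth; the ratios below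
   are therefore genuine. *)
have r_gt0 x : 0 < r x.
  have [n] := ubnP (size (sval x)); elim: n x => // n IH x xn.
  have [->|xr] := eqVneq x root; first by rewrite r_root.
  apply: lt_le_trans (r_sup x xr); apply: ltr_pwDl.
    rewrite mulr_gt0 ?pb_gt0// IH//= size_take.
    have : (0 < size (sval x))%N by rewrite lt0n size_eq0 -val_eqE in xr *.
    by move: xn; case: (size _) => // k; rewrite ltnS /= ltnSn.
  by apply: sumr_ge0 => j _; rewrite mulr_ge0 ?pfwd_ge0.
(* Adjoining 0 makes the supremum non-negative and the set visibly non-empty. *)
pose S i := [set 0] `|` [set 1 - r x / r (danc x) | x in [set x : cover | dlabel x = i]].
have ubS i : ubound (S i) 1.
  move=> _ [->//|[x _ <-]]; rewrite lerBlDr lerDl divr_ge0//.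
have S_sup i : has_sup (S i) by split; [exists 0; left|exists 1].
pose h i := sup (S i).
have h01 i : 0 <= h i <= 1.
  apply/andP; split; first by apply: ub_le_sup; [exists 1|left].
  by apply: ge_sup => //; exists 0; left.
have h_ge (x : cover) : 1 - r x / r (danc x) <= h (dlabel x).
  by apply: ub_le_sup; [exists 1|right; exists x].
have h_ge0 i : 0 <= h i by case/andP: (h01 i).
have Mh0 i := Mact_ge0 i h_ge0.
have hM : escape_bound h.
  split=> // i'; rewrite -ler_pdivlMr ?ltr_wpDr//.
  apply: ge_sup => [|_ [->|[x <- <-]]]; first by exists 0; left.
    by rewrite divr_ge0// addr_ge0.
  have [->|xr] := eqVneq x root.
    rewrite (_ : danc root = root); last exact: val_inj.
    by rewrite divff ?gt_eqF// subrr divr_ge0// addr_ge0.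
  set i := dlabel x.
  have F_child j : E i j -> r x * (1 - h j) <= r (child x j).
    move=> ij; have := h_ge (child x j); rewrite danc_child// dlabel_child// lerBlDr.
    by rewrite -lerBlDl ler_pdivlMr// mulrC.
  (* Bounding the children of [x] below by [r x * (1 - h j)] leads to
     [r (danc x) <= r x * (1 + Mh)], that is, [1 - r x / r (danc x) <= Mh / (1 + Mh)]. *)
  have : pb i * r (danc x) + \sum_(j <- succs i) fwd i j * (r x * (1 - h j)) <= r x.
    apply: le_trans (r_sup x xr); rewrite lerD2l big_seq [leRHS]big_seq.
    apply: ler_sum => j; rewrite mem_succs => ij.
    by rewrite ler_wpM2l ?pfwd_ge0// F_child.
  have -> : \sum_(j <- succs i) fwd i j * (r x * (1 - h j)) =
      r x * (1 - pb i * (1 + Mact h i)).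
    transitivity (\sum_(j <- succs i) (r x * fwd i j - r x * (fwd i j * h j))).
      by apply: eq_bigr => j _; ring.
    by rewrite sumrB -mulr_sumr pfwd_sum -mulr_sumr pfwd_Mact; ring.
  move=> rx; have rd : r (danc x) <= r x * (1 + Mact h i).
    by rewrite -(ler_pM2l (pb_gt0 i)); lra.
  rewrite ler_pdivlMr ?ltr_wpDr// mulrBl mul1r lerBlDl lerD2r.
  by rewrite mulrAC ler_pdivlMr// mul1r.
apply: (recurrent_of_hitoo tree_nbrs_uniq ptree_ge0 ptree_sum1 X_walk) => y yr.
have {yr} y_anc : danc y = root.
  move: yr; rewrite inE => /orP[/eqP ->|/mapP[j]]; first exact: val_inj.
  by rewrite mem_succs => j0 ->; rewrite danc_child.
apply/eqP; rewrite eq_le; apply/andP; split.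
  by apply: hitoo_le1; [exact: ptree_ge0|exact: ptree_sum1].
have := h_ge y; rewrite (h_eq0 _ hM) subr_le0 ler_pdivlMr// mul1r.
by rewrite y_anc r_root.
Qed.

End Walk.

(** * Escape bounds and the upper Collatz-Wielandt number *)

Lemma CW_lower f lam : 0 < lam -> (exists C, forall x, f x <= C) ->
  (forall x, 0 <= f x) -> (exists x, 0 < f x) ->
  (forall x, lam * f x <= Mact f x) -> lam <= upper_CW M.
Proof.
move=> lam0 [C fC] f0 [x0 fx0] fM; apply: ub_le_sup; last first.
  split=> //; exists f; split=> //; last by move=> x; rewrite mx_actE// lee_fin.
    by exists C => x; rewrite ger0_norm.
  by move=> fE; move: fx0; rewrite fE ltxx.
(* A real [sup] dominates the elements of a set only if the set is bounded above; here
   [mu * sup g <= sup Mg <= K * sup g] gives the bound [K]. *)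
have [K K0 MK] := Mact_bounded; exists K => mu [mu0 [g [[D gD] g0 g_neq0 gM]]].
have gle x : g x <= D by apply: le_trans (gD x); rewrite ger0_norm.
have [y gy] : exists y, 0 < g y.
  apply: contra_notP g_neq0 => /forallNP gN; apply/funext => x.
  by apply/eqP; rewrite eq_le g0 andbT leNgt; apply/negP.
pose s := sup (range g).
have gs x : g x <= s.
  by apply: ub_le_sup; [exists D => _ [z _ <-]|exists x].
have s0 : 0 < s by exact: lt_le_trans (gs y).
rewrite -(ler_pM2r s0) -ler_pdivlMl//; apply: ge_sup; first by exists (g y), y.
move=> _ [x _ <-]; rewrite ler_pdivlMl//.
have := gM x; rewrite mx_actE// lee_fin => /le_trans; apply.
by apply: MK => //; exact: ltW.
Qed.

(** The supremum of the empty set is 0 by convention, so [0 < a] guarantees that there are test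
    functions at all. *)
Lemma CW_lt_exists a : 0 < a < upper_CW M -> exists lam f,
  [/\ a < lam, (exists C, forall x, f x <= C), (forall x, 0 <= f x),
      (exists x, 0 < f x) & (forall x, lam * f x <= Mact f x)].
Proof.
move=> /andP[a0]; rewrite /upper_CW; set S := [set lam | _] => aS.
have S0 : S !=set0.
  by apply/set0P/negP => /eqP S0; move: aS; rewrite S0 sup0 ltNge ltW.
have [lam [lam0 [g [[D gD] g0 g_neq0 gM]]] alam] := sup_gt S0 aS.
exists lam, g; split=> //.
- by exists D => x; apply: le_trans (gD x); rewrite ger0_norm.
- apply: contra_notP g_neq0 => /forallNP gN; apply/funext => x.
  by apply/eqP; rewrite eq_le g0 andbT leNgt; apply/negP.
- by move=> x; have := gM x; rewrite mx_actE// lee_fin.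
Qed.

Lemma escape_bound_subinvariant h i : escape_bound h -> h i <= Mact h i.
Proof.
move=> [h01 /(_ i)]; apply: le_trans; rewrite mulrDr mulr1 lerDl.
have h0 j : 0 <= h j by case/andP: (h01 j).
by rewrite mulr_ge0// Mact_ge0.
Qed.

(** The factor is chosen so that [u], the scaled function, satisfies [lam * u <= lam - 1]. With
    [m = Mu], adding [lam * u <= m] and [lam * u * m <= (lam - 1) * m] gives [u * (1 + m) <= m]. *)
Lemma escape_bound_scale lam f C : 1 < lam -> 0 < C -> (forall x, 0 <= f x <= C) ->
  (forall x, lam * f x <= Mact f x) ->
  escape_bound (fun x => (lam - 1) / (lam * C) * f x).
Proof.
move=> lam1 C0 f0C fM; set c := (lam - 1) / (lam * C).
have lam0 : 0 < lam by lra.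
have c0 : 0 < c by rewrite divr_gt0 ?subr_gt0// mulr_gt0.
have cC : lam * (c * C) = lam - 1.
  by rewrite /c; field; rewrite !gt_eqF.
have cf x : lam * (c * f x) <= lam - 1.
  by rewrite -cC !ler_pM2l//; case/andP: (f0C x).
have cf0 x : 0 <= c * f x by apply: mulr_ge0; [exact: ltW|case/andP: (f0C x)].
split=> x.
  by rewrite cf0 -(ler_pM2l lam0) mulr1 (le_trans (cf x))//; lra.
have : c * (lam * f x) <= c * Mact f x by rewrite ler_pM2l.
rewrite MactZ mulrCA; move: (cf x) (cf0 x).
set u := c * f x; set m := c * Mact f x => u1 u0 um.
have m0 : 0 <= m by apply: le_trans um; rewrite mulr_ge0// ltW.
have uml : (lam * u) * m <= (lam - 1) * m by rewrite ler_wpM2r.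
rewrite -(ler_pM2l lam0); lra.
Qed.

(* Irreducibility: passing from f to M f moves positivity one step backwards. *)
Lemma subinvariant_pos lam f i j : 0 < lam -> (exists C, forall x, f x <= C) ->
  (forall x, 0 <= f x) -> (forall x, lam * f x <= Mact f x) -> 0 < f j ->
  exists g, [/\ (exists C, forall x, g x <= C), (forall x, 0 <= g x),
    (forall x, lam * g x <= Mact g x) & 0 < g i].
Proof.
move=> lam0 fC f0 fM fj.
have [s [+ sj]] := let: And5 E_conn _ _ _ _ := data in E_conn i j.
elim: s i sj => [i /= -> _|k s IH i /= sj /andP[ik ks]]; first by exists f.
have [g [[C gC] g0 gM gk]] := IH k sj ks.
exists (Mact g); split.
- have [K K0 MK] := Mact_bounded; exists (K * C) => x; apply: MK => //.
  exact: le_trans (g0 k) (gC k).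
- by move=> x; exact: Mact_ge0.
- by move=> x; rewrite -MactZ; apply: le_Mact.
- exact: Mact_gt0 g0 ik gk.
Qed.

Lemma Mact_seq f i s : uniq s -> (forall j, E i j = (j \in s)) ->
  Mact f i = \sum_(j <- s) M i j * f j.
Proof.
move=> us sE; apply: perm_big; apply: uniq_perm => //; first exact: succs_uniq.
by move=> j; rewrite mem_succs sE.
Qed.

(** At each vertex [[0, pb[] drives the step to the ancestor, and [[pb, 1[], of length the total
    forward probability, is partitioned among the successors. *)
Lemma cover_walk_exists : exists (d : measure_display)
  (Omega : measurableType d) (P : probability Omega R)
  (X : nat -> Omega -> cover), cover_walk P pG pb X.
Proof.
have [selc selP] := choice (fun i => partition_itv i (pb i) (succs_uniq i) (pfwd_ge0 i)).
pose sel i := (selc i).1; pose c i := (selc i).2.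
have c_bnd i j : E i j -> pb i <= c i j /\ c i j + fwd i j <= 1.
  move=> ij; have [/(_ j)+ _] := selP i; rewrite mem_succs => /(_ ij).
  by rewrite pfwd_sum addrCA subrr addr0.
have sel_succ i u : pb i <= u < 1 -> E i (sel i u).
  move=> u01; have [_ /(_ u)] := selP i; rewrite pfwd_sum addrCA subrr addr0.
  by case=> //; rewrite mem_succs.
have selE i j u : pb i <= u < 1 -> E i j ->
    sel i u = j <-> c i j <= u < c i j + fwd i j.
  move=> u01 ij; have [_ /(_ u)] := selP i; rewrite pfwd_sum addrCA subrr addr0.
  by case=> // _; apply; rewrite mem_succs.
pose next (x : cover) (u : R) :=
  if u < pb (dlabel x) then danc x else child x (sel (dlabel x) u).
(* The value 0 is the left endpoint for the ancestor; for all remaining [y] the transition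
   probability vanishes and the interval is empty. *)
pose cc (x y : cover) := if is_child x y then c (dlabel x) (dlabel y) else 0.
apply: (@markov_chain_exists _ _ _ _ cc next).
- exact: ptree_ge0.
- move=> x y; rewrite /cc; case: ifP => // /is_child_edge /c_bnd[+ _].
  by apply: le_trans; rewrite ltW// pb_gt0.
- move=> x y; rewrite /cc /ptree; case: ifP => [/is_child_edge /c_bnd[]//|_].
  rewrite add0r; have pb1 i : pb i <= 1 by have /andP[_ /ltW] := pb_bounds i.
  by do !case: ifP => _ //.
move=> x y u /andP[u0 u1]; rewrite /next /cc; set i := dlabel x.
have [yx|yx] := boolP (is_child x y).
  have xy := is_child_edge yx; have [c1 c2] := c_bnd _ _ xy.
  rewrite /ptree yx; case: ltP => [ui|ui].
    split=> [yE|]; last by rewrite -/i => /andP[cu _]; exfalso; lra.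
    by move: yx; rewrite -yE is_child_danc.
  rewrite -selE ?ui//; split=> [<-|sel_y]; first by rewrite dlabel_child// sel_succ ?ui.
  apply: val_inj; apply: etrans (val_child _) _; first by rewrite sel_succ ?ui.
  by move: yx; rewrite is_childE sel_y => /eqP.
have [->|ya] := eqVneq y (danc x).
  rewrite ptree_danc add0r u0 /=; case: ltP => // ui; split=> // xE.
  by have := is_child_danc x; rewrite -xE is_child_child// sel_succ ?ui.
have -> : ptree pG pb x y = 0.
  rewrite /ptree (negbTE yx) (negbTE ya) andbF.
  case: ifP => // /andP[/eqP xr /eqP yr]; move: ya; rewrite xr yr.
  by rewrite (_ : danc root = root) ?eqxx//; exact: val_inj.
rewrite addr0 (le_lt_asym 0 u); split=> // nxt; exfalso; move: nxt.
case: ltP => ui nxt; first by rewrite nxt eqxx in ya.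
by move: yx; rewrite -nxt is_child_child// sel_succ ?ui.
Qed.

Section Criterion.
Context d (Omega : measurableType d) (P : probability Omega R).
Variable X : nat -> Omega -> cover.
Hypothesis X_walk : cover_walk P pG pb X.

Lemma recurrent_subcritical : upper_CW M < 1 -> recurrent P root X.
Proof.
move=> CW1; apply: (recurrent_of_escape_bound X_walk) => h hM i.
have [h01 _] := hM; have h0 j : 0 <= h j by case/andP: (h01 j).
apply/eqP; rewrite eq_le h0 andbT leNgt; apply/negP => hi.
move: CW1; rewrite ltNge => /negP; apply; apply: (@CW_lower h) => //.
- by exists 1 => x; case/andP: (h01 x).
- by exists i.
- by move=> x; rewrite mul1r; exact: escape_bound_subinvariant.
Qed.

Lemma transient_supercritical : 1 < upper_CW M -> transient P root X.
Proof.
move=> CW1; have [|lam [f [lam1 fC f0 [j fj] fM]]] := @CW_lt_exists 1.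
  by rewrite ltr01.
have lam0 : 0 < lam by lra.
(* The test function may vanish at the label of the root, where the transience criterion needs
   positivity. *)
have [g [[C gC] g0 gM gi]] := subinvariant_pos i0 lam0 fC f0 fM fj.
have C0 : 0 < C by exact: lt_le_trans (gC i0).
have g0C x : 0 <= g x <= C by rewrite g0 gC.
apply: (transient_of_escape_bound X_walk (escape_bound_scale lam1 C0 g0C gM)).
rewrite MactZ; apply: mulr_gt0; first by rewrite divr_gt0 ?subr_gt0 ?mulr_gt0.
by apply: lt_le_trans (gM i0); rewrite mulr_gt0.
Qed.

End Criterion.

End CoverWalk.

(** * The critical case *)

Section CriticalRecurrent.
Variable R : realType.

Let E : rel unit := fun _ _ => true.
Let pG : unit -> unit -> R := fun _ _ => 1.
Let pb : unit -> R := fun=> 2^-1.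

Lemma loop_data : transition_data E pG pb.
Proof.
have unit_card (A : set unit) : (A #<= `I_1)%card.
  apply: card_le_trans (card_image_le (fun=> tt) `I_1).
  by apply: subset_card_le => -[] _; exists 0%N.
split.
- by move=> [] []; exists [::].
- by exists 1%N.
- split=> // -[]; rewrite (@esum_seq _ _ [:: tt])// ?big_seq1//; by case.
- by move=> i j; split.
- by exists (4^-1 : R); split=> [|i]; rewrite /pb; apply/andP; split; lra.
Qed.

Lemma loop_Mact f i : Mact E pG pb f i = f tt.
Proof.
rewrite (@Mact_seq _ _ _ _ _ loop_data _ _ [:: tt])//; case: i.
rewrite big_seq1 /Mmat /pfwd /pG /pb (_ : _ / _ = 1) ?mul1r//.
by rewrite mulr1 -[X in X - _](@divff _ 2)//; field.
Qed.

Lemma loop_CW : upper_CW (Mmat pG pb) = 1.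
Proof.
apply/eqP; rewrite eq_le; apply/andP; split; last first.
  apply: (@CW_lower _ _ _ _ _ loop_data (fun=> 1)) => //.
  - by exists 1.
  - by move=> x; rewrite loop_Mact mulr1.
rewrite leNgt; apply/negP => CW1.
have [|lam [f [lam1 _ _ [[] f0]]]] := @CW_lt_exists _ _ _ _ _ loop_data 1.
  by rewrite ltr01.
by move=> /(_ tt); rewrite loop_Mact; nra.
Qed.

Lemma loop_recurrent d (Omega : measurableType d) (P : probability Omega R) X :
  cover_walk (i0 := tt) P pG pb X -> recurrent P (droot E tt) X.
Proof.
move=> X_walk; apply: (recurrent_of_escape_bound loop_data X_walk) => h [h01 hM] [].
(* Here [hh] reads [h * (1 + h) <= h], so the square of [h] is at most 0. *)
have /andP[h0 _] := h01 tt; have := hM tt; rewrite loop_Mact => hh.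
by apply/eqP; rewrite eq_le h0 andbT; nra.
Qed.

End CriticalRecurrent.

(** * A critical transient walk: the line of natural numbers *)

Section CriticalTransient.
Variable R : realType.

Let E : rel nat := fun i j => (j == i.+1) || (i == j.+1).
Let nbrs (i : nat) : seq nat := i.+1 :: (if i is k.+1 then [:: k] else [::]).

(* The forward weights make h i = 1 / (i + 2) an exact solution of
   h = Mh / (1 + Mh) for the pure shift; the backward weights are only there for
   strong connectedness. *)
Let wt (i j : nat) : R :=
  if j == i.+1 then i.+3%:R / i.+1%:R
  else if i == j.+1 then (12 * i.+1%:R)^-1 else 0.
(** The data are recovered from the desired matrix: [(1 - pb i) / pb i = tot i], so [M] is exactly
    [wt]. *)
Let tot (i : nat) : R := \sum_(j <- nbrs i) wt i j.
Let pb (i : nat) : R := (1 + tot i)^-1.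
Let pG (i j : nat) : R := wt i j / tot i.

Let nbrs_uniq i : uniq (nbrs i).
Proof. by case: i => // i; rewrite /= inE; lia. Qed.

Let nbrsE i j : E i j = (j \in nbrs i).
Proof. by case: i => [|i]; rewrite /E /nbrs !inE ?eqSS ?orbF// [i == j]eq_sym. Qed.

Let wt_up i : wt i i.+1 = i.+3%:R / i.+1%:R.
Proof. by rewrite /wt eqxx. Qed.

Let wt_down i : wt i.+1 i = (12 * i.+2%:R)^-1.
Proof. by rewrite /wt eqxx ltn_eqF. Qed.

Let wt_gt0 i j : 0 < wt i j <-> E i j.
Proof.
rewrite /wt /E; case: eqVneq => [->|_] /=; first by split=> // _; rewrite divr_gt0.
by case: eqVneq => [->|_]; [split=> // _; rewrite invr_gt0 mulr_gt0|rewrite ltxx].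
Qed.

Let wt_ge0 i j : 0 <= wt i j.
Proof.
have [/wt_gt0/ltW//|] := boolP (E i j); rewrite /E /wt negb_or => /andP[/negbTE-> /negbTE->].
exact: lexx.
Qed.

Let tot0 : tot 0 = 3.
Proof. by rewrite /tot big_seq1 wt_up; field. Qed.

Let totS i : tot i.+1 = wt i.+1 i.+2 + wt i.+1 i.
Proof. by rewrite /tot big_cons big_seq1. Qed.

Let wt_up_bounds i : 1 < wt i i.+1 <= 3.
Proof.
rewrite wt_up ltr_pdivlMr// ler_pdivrMr// mul1r ltr_nat !ltnS leqW//= -natrM ler_nat; lia.
Qed.

Let wt_down_bounds i : 0 < wt i.+1 i <= 12^-1.
Proof.
rewrite wt_down invr_gt0 mulr_gt0//= lef_pV2 ?posrE ?mulr_gt0//.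
by rewrite ler_peMr// ler1n.
Qed.

Let tot_bounds i : 1 < tot i < 7/2.
Proof.
case: i => [|i]; first by rewrite tot0; apply/andP; split; lra.
rewrite totS; have /andP[a1 a2] := wt_up_bounds i.+1.
by have /andP[b1 b2] := wt_down_bounds i; apply/andP; split; lra.
Qed.

Let path_conn i j := exists s, path E i s /\ last i s = j.

Lemma line_data : transition_data E pG pb.
Proof.
have tot_gt0 i : 0 < tot i by have /andP[] := tot_bounds i; lra.
split.
- have trans i j k : path_conn i j -> path_conn j k -> path_conn i k.
    move=> [s [ps si]] [t [pt ti]]; exists (s ++ t).
    by rewrite cat_path ps last_cat si pt.
  have down i : path_conn i 0.
    elim: i => [|i IH]; first by exists [::].
    by apply: trans IH; exists [:: i]; rewrite /= /E eqxx orbT.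
  have up i : path_conn 0 i.
    elim: i => [|i IH]; first by exists [::].
    by apply: trans IH _; exists [:: i.+1]; rewrite /= /E eqxx.
  by move=> i j; exact: trans (down i) (up j).
- exists 3%N => i.
  have near (A : set nat) : A `<=` [set j | (j <= i.+1)%N /\ (i <= j.+1)%N] ->
      (* The three candidates are [i - 1], [i] and [i + 1], the images of 0, 1 and 2 under
         [k -> (i + k).-1]. *)
      (A #<= `I_3)%card.
    move=> Asub; apply: card_le_trans (card_image_le (fun k => (i + k).-1) `I_3).
    apply: subset_card_le => j /Asub[ji ij]; exists (j.+1 - i)%N => /=; lia.
  by split; apply: near => j; rewrite /= /E; lia.
- split=> [i j|i]; first by rewrite divr_ge0// ltW.
  rewrite (esum_seq (nbrs_uniq i)).
  + by rewrite /pG -mulr_suml -/(tot i) divff ?gt_eqF.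
  + by move=> j; rewrite divr_ge0// ltW.
  + move=> j; rewrite -nbrsE => /negP ij; rewrite /pG (_ : wt i j = 0) ?mul0r//.
    by apply/eqP; rewrite eq_le wt_ge0 andbT leNgt; apply/negP => /wt_gt0.
- by move=> i j; rewrite -wt_gt0 /pG pmulr_lgt0// invr_gt0.
(* The bounds on [tot] put [pb] strictly between 2/9 and 1/2. *)
- exists (5^-1 : R); split=> [|i]; first by apply/andP; split; lra.
  have /andP[t1 t2] := tot_bounds i.
  have t0 : 0 < 1 + tot i by lra.
  rewrite /pb -[(1 + tot i)^-1]mul1r ltr_pdivlMr// ltr_pdivrMr//.
  by apply/andP; split; lra.
Qed.

Lemma line_Mmat i j : Mmat pG pb i j = wt i j.
Proof.
have /andP[t1 _] := tot_bounds i.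
by rewrite /Mmat /pfwd /pG /pb; field; apply/andP; split; rewrite gt_eqF//; lra.
Qed.

Lemma line_MactS f i : Mact E pG pb f i.+1 = wt i.+1 i.+2 * f i.+2 + wt i.+1 i * f i.
Proof.
rewrite (Mact_seq line_data _ (nbrs_uniq _) (nbrsE _)).
by rewrite big_cons big_seq1 !line_Mmat.
Qed.

Lemma line_Mact0 f : Mact E pG pb f 0 = wt 0 1 * f 1%N.
Proof.
rewrite (Mact_seq line_data _ (nbrs_uniq _) (nbrsE _)).
by rewrite big_seq1 !line_Mmat.
Qed.

Let h (i : nat) : R := i.+2%:R^-1.

(** The forward term alone equals the left-hand side; the backward term is non-negative. *)
Lemma line_Mact_ge i : i.+1%:R^-1 <= Mact E pG pb h i.
Proof.
have -> : i.+1%:R^-1 = wt i i.+1 * h i.+1 :> R.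
  by rewrite wt_up /h mulrC mulKf// pnatr_eq0.
case: i => [|i]; first by rewrite line_Mact0.
by rewrite line_MactS lerDl mulr_ge0// invr_ge0.
Qed.

Lemma line_escape : escape_bound E pG pb h.
Proof.
split=> i; first by rewrite invr_ge0 ler0n invf_le1 ?ler1n.
have := line_Mact_ge i; set m := Mact _ _ _ _ _ => hm.
rewrite mulrDr mulr1 -lerBrDr -[X in X - _]mul1r -mulrBl.
(* The goal has become [h <= (1 - h) * m]; this identity reduces it to [1 / (i + 1) <= m]. *)
have -> : 1 - h i = i.+1%:R * h i.
  have i2 : i.+2%:R != 0 :> R by rewrite pnatr_eq0.
  by apply: (mulIf i2); rewrite mulrBl mul1r mulVf// divfK// -(natr1 i.+1) addrK.
by rewrite mulrAC ler_peMl ?invr_ge0// -ler_pdivrMl// mulr1.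
Qed.

(** The function [h] gives the lower bound. Conversely, [Mf >= lam * f] with [lam > 1] makes [f]
    grow eventually at least by a factor [mu > 1] per step, contradicting boundedness. *)
Lemma line_CW : upper_CW (Mmat pG pb) = 1.
Proof.
apply/eqP; rewrite eq_le; apply/andP; split; last first.
  have [h01 _] := line_escape.
  apply: (@CW_lower _ _ _ _ _ line_data h) => //.
  - by exists 1 => i; have /andP[] := h01 i.
  - by move=> i; rewrite invr_ge0.
  - by exists 0%N; rewrite invr_gt0.
  - by move=> i; rewrite mul1r; exact: escape_bound_subinvariant line_data _ _ line_escape.
rewrite leNgt; apply/negP => CW1.
have [|lam [f [lam1 [C fC] f0 [x0 fx0] fM]]] := @CW_lt_exists _ _ _ _ _ line_data 1.
  by rewrite ltr01.
(* The constant reproduces itself: a backward weight of at most 1/12 times 6 is 1/2, so half of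
   [f i.+1] is at most [3 * f i.+2]. *)
have f6 i : f i <= 6 * f i.+1.
  elim: i => [|i IH].
    have := fM 0%N; have /andP[a1 a2] := wt_up_bounds 0; rewrite line_Mact0.
    have := f0 1%N; have := f0 0%N; nra.
  have := fM i.+1; rewrite line_MactS.
  have /andP[a1 a2] := wt_up_bounds i.+1; have /andP[b1 b2] := wt_down_bounds i.
  have := f0 i; have := f0 i.+1; have := f0 i.+2 => f2 f1 fi.
  have : wt i.+1 i.+2 * f i.+2 <= 3 * f i.+2 by rewrite ler_wpM2r.
  have : wt i.+1 i * f i <= 12^-1 * f i by rewrite ler_wpM2r.
  have : 1 * f i.+1 <= lam * f i.+1 by rewrite ler_wpM2r// ltW.
  lra.
have f_growth i : (lam * i.+2%:R - 2^-1) * f i.+1 <= i.+4%:R * f i.+2.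
  have := fM i.+1; rewrite line_MactS wt_up wt_down => fi.
  have : (12 * i.+2%:R)^-1 * f i <= (12 * i.+2%:R)^-1 * (6 * f i.+1) by rewrite ler_wpM2l.
  have i2 : 0 < i.+2%:R :> R by [].
  move: fi i2; move: (i.+2%:R : R) (i.+4%:R : R) => t v fi t0.
  rewrite -(ler_pM2l t0) => fi6; move: fi; rewrite -(ler_pM2l t0) => fi.
  have t_neq0 : t != 0 by rewrite gt_eqF.
  have e1 : t * ((12 * t)^-1 * (6 * f i.+1)) = 2^-1 * f i.+1 by field.
  have e2 : t * (v / t * f i.+2 + (12 * t)^-1 * f i) = v * f i.+2 + t * ((12 * t)^-1 * f i).
    by field.
  by move: fi fi6; rewrite e1 e2; lra.
have f_pos n : 0 < f (x0 + n)%N.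
  elim: n => [|n IH]; first by rewrite addn0.
  by have := f6 (x0 + n)%N; rewrite addnS; lra.
(* For [mu * (i + 4) <= lam * (i + 2) - 1/2] it suffices that [(lam - 1) * i >= 5], and [lam + 4]
   exceeds 5. *)
have [N0 N0P] : exists N : nat, lam + 4 <= (lam - 1) * N%:R.
  exists (Num.trunc ((lam + 4) / (lam - 1))).+1.
  have l1 : 0 < lam - 1 by lra.
  rewrite -ler_pdivrMl// mulrC ltW// truncnS_gt//.
pose N := (x0 + N0)%N.
pose mu := (1 + lam) / 2.
have f_mu i : (N <= i)%N -> mu * f i.+1 <= f i.+2.
  move=> Ni; rewrite -(ler_pM2l (ltr0Sn R i.+3)).
  apply: le_trans (f_growth i); rewrite mulrA ler_wpM2r//.
  have Ni' : (lam - 1) * N0%:R <= (lam - 1) * i%:R.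
    apply: ler_wpM2l; first by rewrite subr_ge0 ltW.
    by rewrite ler_nat; apply: leq_trans Ni; rewrite leq_addl.
  rewrite -[i.+4]addn4 -[i.+2]addn2 !natrD /mu; lra.
pose del := (mu - 1) * f N.+1.
have del0 : 0 < del.
  by apply: mulr_gt0; [rewrite /mu; lra|rewrite /N -addnS].
(* Linear growth, with the first increment as slope, already exceeds any bound [C]. *)
have f_lin n : f N.+1 + n%:R * del <= f (N + n).+1.
  elim: n => [|n IH]; first by rewrite mul0r addr0 addn0.
  rewrite addnS; have := f_mu (N + n)%N (leq_addr _ _).
  have : (mu - 1) * f N.+1 <= (mu - 1) * f (N + n).+1.
    apply: ler_wpM2l; first by rewrite /mu; lra.
    by apply: le_trans IH; rewrite lerDl mulr_ge0// ltW.
  rewrite -/del -natr1; lra.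
have C0 : 0 <= C by exact: le_trans (f0 0%N) (fC 0%N).
pose n := (Num.trunc (C / del)).+1.
have : C < n%:R * del by rewrite -ltr_pdivrMr// truncnS_gt// .
have := f_lin n; have := fC (N + n).+1; have := f0 N.+1; lra.
Qed.

Lemma line_transient d (Omega : measurableType d) (P : probability Omega R) X :
  cover_walk (i0 := 0%N) P pG pb X -> transient P (droot E 0%N) X.
Proof.
move=> X_walk; apply: (transient_of_escape_bound line_data X_walk line_escape).
by apply: lt_le_trans (line_Mact_ge 0); rewrite invr_gt0.
Qed.

End CriticalTransient.

Theorem theorem3p3 (R : realType) :
  (forall (G : countType) (E : rel G) (i0 : G) (pG : G -> G -> R) (pb : G -> R),
     transition_data E pG pb ->
     forall (d : measure_display) (Omega : measurableType d)
            (P : probability Omega R) (X : nat -> Omega -> dcover E i0),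
     cover_walk P pG pb X ->
     (upper_CW (Mmat pG pb) < 1 -> recurrent P (droot E i0) X) /\
     (1 < upper_CW (Mmat pG pb) -> transient P (droot E i0) X)) /\
  (exists (G : countType) (E : rel G) (i0 : G) (pG : G -> G -> R) (pb : G -> R),
     [/\ transition_data E pG pb,
         upper_CW (Mmat pG pb) = 1 &
         exists (d : measure_display) (Omega : measurableType d)
                (P : probability Omega R) (X : nat -> Omega -> dcover E i0),
           cover_walk P pG pb X /\ transient P (droot E i0) X]) /\
  (exists (G : countType) (E : rel G) (i0 : G) (pG : G -> G -> R) (pb : G -> R),
     [/\ transition_data E pG pb,
         upper_CW (Mmat pG pb) = 1 &
         exists (d : measure_display) (Omega : measurableType d)
                (P : probability Omega R) (X : nat -> Omega -> dcover E i0),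
           cover_walk P pG pb X /\ recurrent P (droot E i0) X]).

Proof.
split=> [G E i0 pG pb data d Omega P X X_walk|].
  split; first exact: recurrent_subcritical data _ _ _ _ X_walk.
  exact: transient_supercritical data _ _ _ _ X_walk.
split.
- have [disp [T [P [X X_walk]]]] := cover_walk_exists 0%N (line_data R).
  do 5 eexists; split; [exact: line_data|exact: line_CW|].
  by exists disp, T, P, X; split=> //; exact: line_transient.
- have [disp [T [P [X X_walk]]]] := cover_walk_exists tt (loop_data R).
  do 5 eexists; split; [exact: loop_data|exact: loop_CW|].
  by exists disp, T, P, X; split=> //; exact: loop_recurrent.
Qed.
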